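(* Given a uniform metrical task system and a bound $\eta_0$ on the prediction error of the PST oracle, the optimal adversary strategy against the LPS algorithm forces it to make $m = Z^{-1}(\eta_0)=\lfloor\sqrt{2\eta_0+1}\rfloor$ state transitions in a phase.
   Context: Uniform metrical task system: a finite set $S$ of $n$ states with transition costs $d(s,s')=1$ for $s\ne s'$ and $d(s,s)=0$. A task is an array $T$ of length $n$, where $T[i]$ is the cost of processing it in state $s_i$. The input is a sequence of tasks, one per time step; an online algorithm chooses at each time $t$ a state, knowing only the tasks up to time $t$, its past states, and any oracle advice, and pays transition costs plus processing costs. Phases and saturation: at the start of a phase all states are unsaturated. A state $s$ is saturated at time $t$ if the total cost of processing, in state $s$, all tasks arriving from the start of the phase through time $t$ is at least $1$; its saturation time in the phase is the first such $t$. When all states are saturated the next phase begins and all states are again unsaturated. A BLS phase algorithm is an algorithm that runs in phases, never processes tasks in a saturated state, and only leaves its current state when that state becomes saturated. PST (Predicted Saturation Time) oracle: at the beginning of each phase it outputs an array $h$ without ties, where $h[i]$ is the predicted saturation time of state $s_i$ in that phase. If $t_i$ is the true saturation time of $s_i$, the prediction error is $\eta=\sum_{i=1}^n |h[i]-t_i|$. The adversary chooses both the task sequence and the oracle's predictions, subject to $\eta\le\eta_0$. An adversary strategy is optimal if it forces as many state transitions in a phase as possible under this constraint. LPS (Last Predicted State) algorithm: the BLS phase algorithm which queries the PST oracle at the beginning of each phase and always transitions to the unsaturated state with the latest predicted saturation time (at the start of the phase, and whenever its current state becomes saturated while unsaturated states remain). $Z(m)=\frac{m^2-1}{2}$ for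 odd $m$ and $Z(m)=\frac{m^2}{2}$ for even $m$; $Z^{-1}$ is defined by $Z^{-1}(\eta)=\lfloor\sqrt{2\eta+1}\rfloor$.
   Formalization: The number of forced transitions is given as min(n, Z^{-1}(η_0)), since a phase with n states never has more than n transitions, so the uncapped formula fails when Z^{-1}(η_0) > n; at least two states are assumed, since with one state no transition exists. *)

(* Defs.v *)
From HB Require Import structures.
From mathcomp Require Import all_boot all_order all_algebra.
From mathcomp Require Import reals.

Set Implicit Arguments.
Unset Strict Implicit.
Unset Printing Implicit Defensive.

Import Order.TTheory GRing.Theory Num.Theory.

Local Open Scope ring_scope.

(* Time steps are natural numbers.  The first phase starts at time 0 and tasks
   arrive at times 1, 2, ...; the value [task 0] is never used.  As LPS is
   deterministic, an adversary loses nothing by fixing in advance the whole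
   input and, for every phase number, the array output by the oracle. *)
Record strategy (R : realType) (n : nat) := Strategy {
  task : nat -> 'I_n -> R;
  predicted : nat -> 'I_n -> nat;
  task_ge0 : forall t i, 0 <= task t i;
  predicted_inj : forall k, injective (predicted k)
}.

Section Game.
Context {R : realType} {n : nat}.
Implicit Types (A : strategy R n) (s : 'I_n).

(* In a phase starting at time b, the tasks that count are those arriving at
   times b + 1, b + 2, ...: a task that saturates the last unsaturated state
   belongs to the phase it terminates. *)
Definition saturated A (b t : nat) s : bool :=
  1 <= \sum_(b.+1 <= u < t.+1) task A u s.

(* [phase A t = (k, b)]: at time t the current phase is the k-th one (counting
   from 0), and it started at time b. *)
Fixpoint phase A (t : nat) : nat * nat :=
  if t is t'.+1 then
    let: (k, b) := phase A t' in
    if [forall s, saturated A b t s] then (k.+1, t) else (k, b)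
  else (0, 0)%N.

(* The state of P maximizing h when P is nonempty; the default s0 is returned
   only when P is empty. *)
Definition latest (h : 'I_n -> nat) (s0 : 'I_n) (P : pred 'I_n) : 'I_n :=
  [arg max_(s > s0 | P s) h s]%N.

(* [LPS s0 A t] is the state chosen at time t, once the task of time t is
   known, and in which this task is processed; s0 is the state occupied before
   the first phase. *)
Fixpoint LPS (s0 : 'I_n) A (t : nat) : 'I_n :=
  if t is t'.+1 then
    let: (k, b) := phase A t in
    let s := LPS s0 A t' in
    if b == t then latest (predicted A k) s predT
    else if saturated A b t s then
      latest (predicted A k) s (fun s' => ~~ saturated A b t s')
    else s
  else latest (predicted A 0) s0 predT.

Definition previous_state (s0 : 'I_n) A (t : nat) : 'I_n :=
  if t is t'.+1 then LPS s0 A t' else s0.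

(* The k-th phase starts at time b and the next one at time e. *)
Definition is_phase A (k b e : nat) : Prop :=
  phase A b = (k, b) /\ phase A e = (k.+1, e).

(* The move made at the start of the phase belongs to the phase; the one made
   at time e belongs to the next phase. *)
Definition transitions (s0 : 'I_n) A (b e : nat) : nat :=
  (\sum_(b <= t < e) (previous_state s0 A t != LPS s0 A t))%N.

Definition saturation_time A (b : nat) s (t : nat) : Prop :=
  saturated A b t s /\ forall u, (u < t)%N -> ~~ saturated A b u s.

Definition prediction_error (h tau : 'I_n -> nat) : nat :=
  (\sum_(s < n) `|(h s)%:Z - (tau s)%:Z|)%N.

(* The error of a phase that never ends is infinite, hence every phase of an
   admissible strategy terminates. *)
Definition admissible (eta0 : nat) A : Prop :=
  forall k, exists b e (tau : 'I_n -> nat),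
    [/\ is_phase A k b e,
        forall s, saturation_time A b s (tau s)
      & (prediction_error (predicted A k) tau <= eta0)%N].

Definition forces (s0 : 'I_n) A (k m : nat) : Prop :=
  exists b e, is_phase A k b e /\ transitions s0 A b e = m.

Definition optimal (s0 : 'I_n) (eta0 k : nat) A : Prop :=
  admissible eta0 A /\
  forall A' m m', admissible eta0 A' ->
    forces s0 A k m -> forces s0 A' k m' -> (m' <= m)%N.

(* BLS phase algorithms: [x t] is the state in which the task of time t is
   processed. *)
Definition BLS A (x : nat -> 'I_n) : Prop :=
  forall t,
    ~~ saturated A (phase A t).2 t (x t) /\
    (x t.+1 != x t -> saturated A (phase A t).2 t.+1 (x t)).

Lemma saturated_start A b s : ~~ saturated A b b s.
Proof. by rewrite /saturated big_geq // -ltNge ltr01. Qed.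

Lemma phase_le A t : ((phase A t).2 <= t)%N.
Proof.
elim: t => //= t; case: (phase A t) => k b /= le_bt.
by case: ifP => //= _; apply: leq_trans le_bt _.
Qed.

Lemma LPS_BLS s0 A : BLS A (LPS s0 A).
Proof.
have unsat t : ~~ saturated A (phase A t).2 t (LPS s0 A t).
  case: t => [|t]; first exact: saturated_start.
  have := phase_le A t; rewrite /=; case: (phase A t) => k b /= le_bt.
  case: ifPn => [_|]; first by rewrite eqxx saturated_start.
  rewrite negb_forall => /existsP[s1 s1P].
  rewrite ltn_eqF ?ltnS //; case: ifPn => // _.
  rewrite /latest /arg_max /extremum; case: pickP => [s /andP[] //|none].
  case: (@arg_maxnP _ s1 (fun s => ~~ saturated A b t.+1 s) (predicted A k) s1P).
  move=> s sP smax; have /negbT/negP[] := none s; rewrite /= sP /=.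
  by apply/forallP => s'; apply/implyP; apply: smax.
move=> t; split=> //=; have := phase_le A t.
case: (phase A t) => k b /= le_bt.
case: ifPn => [/forallP allsat _ //|_].
rewrite ltn_eqF ?ltnS //; case: ifPn => // _; by rewrite eqxx.
Qed.

End Game.

Definition Zinv (R : realType) (eta : nat) : nat :=
  Num.truncn (Num.sqrt ((2 * eta + 1)%:R : R)).

(* Main.v *)
(** In a phase, let x_0, x_1, ... be the states visited by LPS.  Each is the
    predicted last among the states still unsaturated, so the predicted times
    strictly decrease along the sequence while the true saturation times
    strictly increase; hence the differences h(x_j) - t(x_j) drop by at least 2
    at each step, and pairing the two extreme ones inductively shows that m
    visited states cost an error of at least (m^2 - 1)/2.  Conversely, with
    phases of length n in which one state saturates at every step, predicting
    the last m saturations in reverse order makes LPS visit exactly these m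
    states with error (m^2 - 1)/2 for odd m and m^2/2 for even m. *)

Require Import Defs.
From mathcomp Require Import all_boot all_order all_algebra.
From mathcomp Require Import reals.
From mathcomp Require Import all_fingroup zify.

Set Implicit Arguments.
Unset Strict Implicit.
Unset Printing Implicit Defensive.

Import Order.TTheory GRing.Theory Num.Theory.

Local Open Scope ring_scope.

(** * Integer arithmetic of the bound *)

Lemma leq_Zinv (R : realType) (m eta : nat) :
  (m <= Zinv R eta)%N = (m ^ 2 <= 2 * eta + 1)%N.
Proof.
rewrite /Zinv -(@ler_nat R (m ^ 2)) natrX.
have s_ge0 : (0 <= Num.sqrt ((2 * eta + 1)%:R : R))%R by exact: sqrtr_ge0.
rewrite truncn_ge_nat // -[in RHS](sqr_sqrtr (ler0n R (2 * eta + 1))).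
by rewrite ler_sqr // nnegrE ler0n.
Qed.

Lemma path_gap2 (x : int) (s : seq int) :
  path (fun y z => y + 2 <= z)%R x s ->
  (x + (2 * size s)%:Z <= last x s)%R.
Proof.
elim: s x => [|y s IHs] x /=; first by lia.
by move=> /andP[xy /IHs]; lia.
Qed.

(** Induct by removing both ends. With k terms they lie at least 2(k - 1) apart, so their absolute
    values add up to at least that, and k^2 - (k - 2)^2 = 4(k - 1). *)
Lemma sum_abs_gap2 (s : seq int) :
  sorted (fun y z => y + 2 <= z)%R s ->
  (size s ^ 2 <= 2 * (\sum_(x <- s) `|x|) + 1)%N.
Proof.
elim/ltn_ind: {s}_.+1 {-2}s (ltnSn (size s)) => m IHm [|x s] //=.
case/lastP: s => [_ _|s y]; first by rewrite big_seq1 /=; lia.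
rewrite size_rcons => lt_s.
move=> pxy; have := path_gap2 pxy; rewrite last_rcons size_rcons => gap.
have /IHm : (size s < m.-1)%N by lia.
have: sorted (fun y z => y + 2 <= z)%R s.
  by move: pxy; rewrite rcons_path => /andP[/path_sorted].
move=> ss /(_ ltac:(lia) ss).
rewrite big_cons -cats1 big_cat big_seq1 /=; lia.
Qed.

(** The progression m - 1, m - 3, ..., 1 - m attains the minimum: its sum of absolute values is
    Z(m). Dropping both ends leaves the progression for m - 2. *)
Lemma sum_abs_centered (m : nat) :
  ((\sum_(j < m) `|(m%:Z - 1)%R - (2 * j)%N%:Z|)%N.*2 + odd m = m ^ 2)%N.
Proof.
elim/ltn_ind: m => -[|[|m]] IHm; [by rewrite big_ord0 | by rewrite big_ord1 | ].
have := IHm m ltac:(lia).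
rewrite big_ord_recl big_ord_recr /= negbK.
have -> : (\sum_(i < m)
    `|(m.+2%:Z - 1)%R - (2 * bump 0 (widen_ord (leqnSn m) i))%N%:Z|
  = \sum_(i < m) `|(m%:Z - 1)%R - (2 * i)%N%:Z|)%N.
  by apply: eq_bigr => i _ /=; rewrite /bump /=; lia.
rewrite /bump /=; lia.
Qed.

Lemma latestP (n : nat) (h : 'I_n -> nat) (s0 s1 : 'I_n) (P : pred 'I_n) :
  P s1 ->
  P (latest h s0 P) /\ forall s, P s -> (h s <= h (latest h s0 P))%N.
Proof.
move=> Ps1; rewrite /latest /arg_max /extremum.
case: pickP => [s /andP[Ps /forallP hs]|none].
  by split=> // s' Ps'; have /implyP := hs s'; apply.
case: (@arg_maxnP _ s1 P h Ps1) => s Ps smax.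
have /negbT/negP[] := none s; rewrite /= Ps /=.
by apply/forallP => s'; apply/implyP; apply: smax.
Qed.

Lemma latest_eq (n : nat) (h : 'I_n -> nat) (s0 s : 'I_n) (P : pred 'I_n) :
  injective h -> P s -> (forall s', P s' -> (h s' <= h s)%N) ->
  latest h s0 P = s.
Proof.
move=> h_inj Ps smax; have [Pl lmax] := latestP h s0 Ps.
by apply/h_inj/eqP; rewrite eqn_leq smax // lmax.
Qed.

(** * Phases, saturation, and the upper bound on transitions *)

Section UpperBound.
Variables (R : realType) (n : nat).
Implicit Types (A : strategy R n) (s : 'I_n).

Lemma phaseS A t :
  phase A t.+1 =
  if [forall s, saturated A (phase A t).2 t.+1 s]
  then ((phase A t).1.+1, t.+1) else phase A t.
Proof. by rewrite /=; case: (phase A t) => k b /=; case: ifP. Qed.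

Lemma LPSS s0 A t :
  LPS s0 A t.+1 =
  if (phase A t.+1).2 == t.+1
  then latest (predicted A (phase A t.+1).1) (LPS s0 A t) predT
  else if saturated A (phase A t.+1).2 t.+1 (LPS s0 A t) then
    latest (predicted A (phase A t.+1).1) (LPS s0 A t)
      (fun s => ~~ saturated A (phase A t.+1).2 t.+1 s)
  else LPS s0 A t.
Proof.
rewrite [LHS]/= -/(phase A t.+1).
by rewrite [phase A t.+1]/=; case: (phase A t) => k b; case: ifP.
Qed.

(** The start of a phase changes only together with its number; hence the number determines the
    start. *)
Lemma phase_mono A t u : (t <= u)%N ->
  ((phase A t).1 < (phase A u).1)%N \/ phase A t = phase A u.
Proof.
elim: u => [|u IHu]; first by rewrite leqn0 => /eqP->; right.
rewrite leq_eqVlt => /orP[/eqP->|]; first by right.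
rewrite ltnS => /IHu; rewrite phaseS; case: ifP => // _ [lt|->] /=; left; lia.
Qed.

Lemma phase_start_uniq A k b b' :
  phase A b = (k, b) -> phase A b' = (k, b') -> b = b'.
Proof.
wlog le_bb' : b b' / (b <= b')%N => [hw pb pb'|pb pb'].
  by case/orP: (leq_total b b') => /hw; [apply|move=> h; rewrite h].
by have := phase_mono A le_bb'; rewrite pb pb' ltnn => -[//|[]].
Qed.

Lemma is_phase_uniq A k b e b' e' :
  is_phase A k b e -> is_phase A k b' e' -> b = b' /\ e = e'.
Proof.
move=> [pb pe] [pb' pe'].
by split; [apply: phase_start_uniq pb pb'|apply: phase_start_uniq pe pe'].
Qed.

Lemma phase_within A k b e t :
  is_phase A k b e -> (b <= t < e)%N -> phase A t = (k, b).
Proof.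
move=> [pb pe] /andP[le_bt lt_te].
have [] := phase_mono A le_bt; rewrite pb //= => lt_k.
have [] := phase_mono A (ltnW lt_te); rewrite pe //=.
  by move=> lt_kS; exfalso; lia.
by move=> pt; have := phase_le A t; rewrite pt /=; lia.
Qed.

Lemma saturated_leq A b t u s :
  (t <= u)%N -> saturated A b t s -> saturated A b u s.
Proof.
rewrite /saturated => le_tu sat_t; apply: le_trans sat_t _.
have [le_bt|lt_tb] := leqP b t; last first.
  rewrite [X in (X <= _)%R]big_geq; first by apply: sumr_ge0 => *; apply: task_ge0.
  lia.
rewrite [X in (_ <= X)%R](@big_cat_nat _ _ _ t.+1) //= ?ltnS //.
by rewrite lerDl sumr_ge0 // => *; apply: task_ge0.
Qed.

Lemma saturation_time_gt A b s tau t :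
  saturation_time A b s tau -> (t < tau)%N = ~~ saturated A b t s.
Proof.
move=> [sat_tau unsat]; apply/idP/idP => [/unsat//|].
by apply: contraR; rewrite -leqNgt => /saturated_leq; apply.
Qed.

Lemma LPS_unsaturated s0 A k b e t :
  is_phase A k b e -> (b <= t < e)%N -> ~~ saturated A b t (LPS s0 A t).
Proof.
move=> ph bte; have [+ _] := LPS_BLS s0 A t.
by rewrite (phase_within ph bte).
Qed.

(** While LPS stays put, the set of unsaturated states can only shrink, so the maximality obtained
    at the last choice persists. *)
Lemma LPS_latest s0 A k b e t s :
  is_phase A k b e -> (b <= t < e)%N -> ~~ saturated A b t s ->
  (predicted A k s <= predicted A k (LPS s0 A t))%N.
Proof.
move=> ph; elim: t => [|t IHt] bte.
  have [b0 _] := ph; move: (bte); rewrite leqn0 => /andP[/eqP b0' _] _.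
  move: b0; rewrite b0' => -[<-] /=.
  by have [_] := @latestP _ (predicted A 0) s0 s0 predT isT; apply.
move=> unsat; rewrite LPSS (phase_within ph bte) /=.
case: eqP => [_|/eqP b_neq].
  by have [_] := @latestP _ (predicted A k) (LPS s0 A t) s predT isT; apply.
case: ifP => _.
  have [_] := @latestP _ (predicted A k) (LPS s0 A t) s
    (fun s => ~~ saturated A b t.+1 s) unsat.
  by apply.
by apply: IHt; [lia | apply: contraNN unsat; apply: saturated_leq].
Qed.

(** The list holds the visited states, most recent first, with the current state as its head. This
    is only an inequality because the opening choice may be the state already occupied. *)
Lemma LPS_visited s0 A k b e tau t :
  is_phase A k b e -> (forall s, saturation_time A b s (tau s)) ->
  (b <= t < e)%N ->
  exists v : seq 'I_n,
    path (fun x y => (predicted A k x < predicted A k y) && (tau y < tau x))%N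
      (LPS s0 A t) v
    /\ (transitions s0 A b t.+1 <= (size v).+1)%N.
Proof.
move=> ph tauP /andP[le_bt]; rewrite -(subnKC le_bt).
elim: (t - b)%N => [|j IHj] lt_e.
  exists [::]; split=> //; rewrite addn0 /transitions big_nat1; by case: (_ != _).
have [v [pv tr]] := IHj ltac:(lia); rewrite addnS.
have trS : transitions s0 A b (b + j).+2 =
    (transitions s0 A b (b + j).+1 + (LPS s0 A (b + j) != LPS s0 A (b + j).+1))%N.
  by rewrite /transitions big_nat_recr //=; lia.
have [eqL|neqL] := eqVneq (LPS s0 A (b + j)) (LPS s0 A (b + j).+1).
  by exists v; rewrite -eqL trS eqL eqxx addn0 -eqL.
exists (LPS s0 A (b + j) :: v); rewrite trS neqL [path _ _ _]/= pv andbT.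
split; last by rewrite addn1.
have sat : saturated A b (b + j).+1 (LPS s0 A (b + j)).
  have [_] := LPS_BLS s0 A (b + j); rewrite eq_sym => /(_ neqL).
  by rewrite (@phase_within _ _ _ _ (b + j) ph) //; lia.
have unsat := @LPS_unsaturated s0 _ _ _ _ (b + j).+1 ph ltac:(lia).
apply/andP; split; first (rewrite ltn_neqAle; apply/andP; split).
- by rewrite (inj_eq (@predicted_inj _ _ A k)) eq_sym.
- apply: (LPS_latest s0 ph); first by lia.
  by apply: contraNN unsat; apply: saturated_leq.
(* The time of the move separates the two saturation times: the state left is saturated by then, the
   state entered is not. *)
- apply: (@leq_ltn_trans (b + j).+1); last by rewrite (saturation_time_gt _ (tauP _)).
  by rewrite leqNgt (saturation_time_gt _ (tauP _)) sat.
Qed.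

Lemma visited_bound (h tau : 'I_n -> nat) (v : seq 'I_n) :
  sorted (fun x y => (h x < h y) && (tau y < tau x))%N v ->
  (size v <= n)%N /\ (size v ^ 2 <= 2 * prediction_error h tau + 1)%N.
Proof.
move=> sv.
have v_uniq : uniq v.
  apply: sorted_uniq sv; last by move=> x; rewrite ltnn.
  by move=> y x z /andP[? ?] /andP[? ?]; apply/andP; split; lia.
split; first by rewrite -[X in (_ <= X)%N]card_ord -(card_uniqP v_uniq) max_card.
pose d s : int := ((h s)%:Z - (tau s)%:Z)%R.
have sd : sorted (fun y z => y + 2 <= z)%R (map d v).
  by apply: homo_sorted sv => x y /andP[? ?]; rewrite /d; lia.
have := sum_abs_gap2 sd; rewrite size_map big_map big_uniq //= => le1.
apply: leq_trans le1 _; rewrite leq_add2r leq_mul2l /=.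
(* The visited states are distinct, so their errors form a partial sum of the total error. *)
by rewrite /prediction_error [X in (_ <= X)%N](bigID (mem v)) /= leq_addr.
Qed.

Lemma transitions_le s0 A (eta0 k m : nat) :
  admissible eta0 A -> forces s0 A k m -> (m <= minn n (Zinv R eta0))%N.
Proof.
move=> /(_ k)[b [e [tau [ph tauP err]]]] [b' [e' [ph' <-]]].
have [<- <-] := is_phase_uniq ph ph'.
have lt_be : (b < e)%N.
  have [pb pe] := ph; rewrite ltnNge; apply/negP => le_eb.
  by have := phase_mono A le_eb; rewrite pb pe /= => -[|[]]; lia.
have [v [pv]] := @LPS_visited s0 _ _ _ _ tau e.-1 ph tauP ltac:(lia).
rewrite prednK ?(leq_ltn_trans _ lt_be) // => tr.
have [le_n le_err] := visited_bound (v := _ :: _) pv.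
apply: leq_trans tr _; rewrite leq_min le_n leq_Zinv /=.
by apply: leq_trans le_err _; lia.
Qed.

End UpperBound.

(** * An adversary attaining the bound *)

Section Construction.
(* [q k s] is the rank, from 0 to n - 1, of s in the order of saturation during
   the k-th phase, which lasts from time k * n to time k.+1 * n. *)
Variables (R : realType) (n m : nat) (q : nat -> {perm 'I_n}).
Hypotheses (m_gt0 : (0 < m)%N) (m_le_n : (m <= n)%N).

(** Tasks start at time 1, hence the shift: the state of rank r saturates at time k * n + r + 1. *)
Definition adv_task (t : nat) (s : 'I_n) : R :=
  if t is u.+1 then (q (u %/ n)%N s == (u %% n)%N :> nat)%:R else 0.

(** Ranks below n - m are predicted exactly; the reflection r -> 2n - m - 1 - r reverses the
    interval from n - m to n - 1. *)
Definition adv_predicted (k : nat) (s : 'I_n) : nat :=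
  (k * n + (if q k s < n - m then q k s : nat else 2 * n - m - 1 - q k s))%N.+1.

Lemma adv_task_ge0 t s : 0 <= adv_task t s.
Proof. by case: t => [|u] //=; rewrite ler0n. Qed.

Lemma adv_predicted_inj k : injective (adv_predicted k).
Proof.
move=> s s' eq_h; apply/(@perm_inj _ (q k))/val_inj => /=; move: eq_h.
rewrite /adv_predicted; have := ltn_ord (q k s); have := ltn_ord (q k s').
by do 2!case: ifP; lia.
Qed.

Definition adversary : strategy R n := Strategy adv_task_ge0 adv_predicted_inj.

Lemma adv_saturated k j s :
  (j <= n)%N -> saturated adversary (k * n) (k * n + j) s = (q k s < j)%N.
Proof.
move=> le_jn; rewrite /saturated big_add1 /= -natr_sum ler1n lt0n.
rewrite sum_nat_seq_neq0; apply/hasP/idP => [[u]|lt_qj].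
  rewrite mem_index_iota => /andP[le_u lt_u] /=.
  have lt_n : (u - k * n < n)%N by lia.
  rewrite -(subnKC le_u) eqb0 negbK divnMDl ?modnMDl; last by lia.
  by rewrite divn_small // modn_small // addn0 => /eqP->; lia.
exists (k * n + q k s)%N; first by rewrite mem_index_iota; lia.
rewrite /= eqb0 negbK divnMDl ?modnMDl; last by lia.
by rewrite divn_small // modn_small // addn0.
Qed.

Lemma adv_phase_aux k j : (j < n)%N -> phase adversary (k * n) = (k, (k * n)%N) ->
  phase adversary (k * n + j) = (k, (k * n)%N).
Proof.
move=> + pk; elim: j => [|j IHj] lt_jn; first by rewrite addn0.
rewrite addnS phaseS IHj ?(ltnW lt_jn) //= -addnS.
case: ifP => // /forallP/(_ ((q k)^-1%g (Ordinal lt_jn))).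
by rewrite adv_saturated ?permKV ?ltnn // ltnW.
Qed.

Lemma adv_phase_start k : phase adversary (k * n) = (k, (k * n)%N).
Proof.
elim: k => // k IHk; have n_gt0 : (0 < n)%N by lia.
have -> : (k.+1 * n = (k * n + n.-1).+1)%N by lia.
rewrite phaseS adv_phase_aux ?prednK //= -addnS prednK //.
case: ifP => // /negbT/forallPn[s]; by rewrite adv_saturated // ltn_ord.
Qed.

Lemma adv_phase k j : (j < n)%N ->
  phase adversary (k * n + j) = (k, (k * n)%N).
Proof. by move=> lt_jn; apply: adv_phase_aux => //; apply: adv_phase_start. Qed.

Lemma adv_is_phase k : is_phase adversary k (k * n) (k.+1 * n).
Proof. by split; apply: adv_phase_start. Qed.

Lemma adv_saturation_time k s :
  saturation_time adversary (k * n) s (k * n + q k s).+1.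
Proof.
split=> [|u]; first by rewrite -addnS adv_saturated.
rewrite ltnS => le_u; apply: (contraNN (saturated_leq le_u)).
by rewrite adv_saturated ?ltnn // ltnW.
Qed.

Lemma adv_prediction_error k :
  prediction_error (adv_predicted k) (fun s => (k * n + q k s).+1)
  = (\sum_(j < m) `|(m%:Z - 1)%R - (2 * j)%N%:Z|)%N.
Proof.
(* [F r] is the error at rank r; at rank n - m + j the signed error is m - 1 - 2j. *)
pose F r := if (r < n - m)%N then 0%N
  else (`|(m%:Z - 1)%R - (2 * (r - (n - m)))%N%:Z|)%N.
rewrite /prediction_error [LHS](eq_bigr (fun s => F (q k s))); last first.
  move=> s _; rewrite /adv_predicted /F; have := ltn_ord (q k s).
  by case: ifP; lia.
rewrite -(reindex_inj (P := predT) (F := fun s : 'I_n => F s) (@perm_inj _ (q k))) /=.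
rewrite -(big_mkord predT F) (@big_cat_nat _ _ _ (n - m)) ?leq_subr //=.
rewrite big_nat big1 => [|r /andP[_ lt_r]]; last by rewrite /F lt_r.
rewrite add0n -{1}[(n - m)%N]add0n big_addn subKn // big_mkord.
by apply: eq_bigr => j _; rewrite /F; case: ifP; lia.
Qed.

Lemma adv_admissible eta0 :
  (m ^ 2 <= 2 * eta0 + 1)%N -> admissible eta0 adversary.
Proof.
move=> le_m k; exists (k * n)%N, (k.+1 * n)%N, (fun s => (k * n + q k s).+1).
split; [exact: adv_is_phase | exact: adv_saturation_time |].
by rewrite adv_prediction_error; have := sum_abs_centered m; case: odd; lia.
Qed.

(** Rank n - m has the latest prediction and is kept until it saturates, at offset n - m + 1. From
    then on the reversed predictions select the next rank to saturate, so LPS moves at every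
    step. *)
Lemma adv_LPS s0 k j : (j < n)%N ->
  q k (LPS s0 adversary (k * n + j)) = maxn (n - m) j :> nat.
Proof.
have state r : (r < n)%N -> exists s, q k s = r :> nat.
  by move=> lt_r; exists ((q k)^-1%g (Ordinal lt_r)); rewrite ?permKV.
elim: j => [|j IHj] lt_jn.
  have [s qs] := state (n - m)%N ltac:(lia).
  suff -> : LPS s0 adversary (k * n + 0) = s by rewrite maxn0.
  have top x : latest (adv_predicted k) x predT = s.
    apply: latest_eq => //; first exact: adv_predicted_inj.
    move=> s' _; rewrite /adv_predicted qs ltnn; have := ltn_ord (q k s').
    by case: ifP; lia.
  rewrite addn0; case: k top {state qs} => [|k] top; first exact: top.
  have kE : (k.+1 * n = (k.+1 * n).-1.+1)%N by lia.
  by rewrite kE LPSS -kE adv_phase_start eqxx top.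
rewrite addnS LPSS -addnS adv_phase //=.
rewrite ifF; last by apply/eqP; lia.
rewrite adv_saturated; last exact: ltnW.
have {}IHj := IHj ltac:(lia); rewrite IHj; case: ifP => lt_j; last by rewrite IHj; lia.
have [s qs] := state j.+1 lt_jn.
rewrite (@latest_eq _ _ _ s); first by rewrite qs; lia.
- exact: adv_predicted_inj.
- by rewrite adv_saturated ?qs ?ltnn // ltnW.
- move=> s'; rewrite adv_saturated; last exact: ltnW.
  rewrite /adv_predicted qs; have := ltn_ord (q k s').
  by do 2!case: ifP; lia.
Qed.

(** The hypothesis makes the opening move a genuine transition, since the previous phase ends in its
    state of rank n - 1. The offsets above n - m give the other m - 1. *)
Lemma adv_transitions s0 k :
  (forall s, q k s = (n - m)%N :> nat ->
     if k is k'.+1 then q k' s != n.-1 :> nat else s != s0) ->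
  transitions s0 adversary (k * n) (k.+1 * n) = m.
Proof.
move=> start; rewrite /transitions.
rewrite -{1}[(k * n)%N]add0n big_addn mulSn addnK big_nat.
rewrite (eq_bigr (fun j => ((j == 0) || (n - m < j))%N : nat)); last first.
  move=> [_|j lt_jn]; last first.
    rewrite addSn addnC [previous_state _ _ _]/= -addnS.
    rewrite -(inj_eq (@perm_inj _ (q k))) -val_eqE /= !adv_LPS; lia.
  have n_gt0 : (0 < n)%N by lia.
  congr nat_of_bool; have := @adv_LPS s0 k 0 n_gt0; rewrite add0n addn0 maxn0.
  move/start; rewrite eq_sym; case: k {start} => // k.
  have kE : (k.+1 * n = (k * n + n.-1).+1)%N by lia.
  rewrite kE [previous_state _ _ _]/=; apply: contraNneq => <-.
  by rewrite adv_LPS ?prednK //; lia.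
rewrite -big_nat.
have count c i : (\sum_(0 <= j < i.+1) ((j == 0) || (c < j)) = (i - c).+1)%N.
  by elim: i => [|i IHi]; rewrite ?big_nat1 // big_nat_recr //= IHi; lia.
by have := count (n - m)%N n.-1; rewrite prednK; lia.
Qed.

End Construction.

(** * Cyclic rankings and the optimal value *)

Lemma shift_ord_inj n c (n_gt0 : (0 < n)%N) :
  injective (fun s : 'I_n => Ordinal (ltn_pmod (s + c) n_gt0)).
Proof.
move=> s s' [/eqP]; rewrite eqn_modDr !modn_small // => /eqP; exact: val_inj.
Qed.

Theorem theorem2 (R : realType) (n : nat) (n_gt1 : (1 < n)%N) (s0 : 'I_n)
    (eta0 : nat) :
  (exists A : strategy R n, forall k : nat, optimal s0 eta0 k A) /\
  (forall (A : strategy R n) (k : nat),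
     optimal s0 eta0 k A -> forces s0 A k (minn n (Zinv R eta0))).
Proof.
set m := minn n (Zinv R eta0).
have m_gt0 : (0 < m)%N by rewrite leq_min (ltnW n_gt1) leq_Zinv; lia.
have m_le_n : (m <= n)%N by exact: geq_minl.
have n_gt0 := ltnW n_gt1.
(* The start of a phase must cost a transition, so the first state to be
   visited must differ from the last one saturated before (from s0 at time 0).
   When m = 1 this requires the ranking to change from one phase to the next. *)
pose d : nat := (m == 1%N).
(* The offset [n - s0.+1] gives [s0] rank n - 1 in a fictitious phase preceding phase 0. *)
pose q k := perm (@shift_ord_inj n (k.+1 * d + (n - s0.+1)) n_gt0).
have qE k s : q k s = ((s + (k.+1 * d + (n - s0.+1))) %% n)%N :> nat by rewrite permE.
pose A := adversary R q m_gt0 m_le_n.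
have A_adm : admissible eta0 A.
  apply: adv_admissible; rewrite -(leq_Zinv R); exact: geq_minr.
have A_forces k : forces s0 A k m.
  exists (k * n)%N, (k.+1 * n)%N; split; first exact: adv_is_phase.
  apply: adv_transitions => s; rewrite qE.
  (* For m = 1, rank n - 1 becomes 0, which differs from n - 1 as n > 1; otherwise ranks are fixed
     and n - m < n - 1. *)
  have shift x : ((x + d) %% n = n - m)%N -> (x %% n)%N != n.-1.
    move=> x_d; apply/eqP => x_n; move: x_d; rewrite -modnDml x_n /d.
    case: eqP => [->|m_neq1] /=; first by rewrite addn1 prednK // modnn; lia.
    by rewrite addn0 modn_small ?prednK //; lia.
  case: k => [|k] qs; last by rewrite qE; apply: shift; rewrite -qs; congr modn; lia.
  apply/eqP => s_s0; have /shift : ((n.-1 + d) %% n = n - m)%N.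
    by rewrite -qs s_s0; congr modn; have := ltn_ord s0; lia.
  by rewrite modn_small ?prednK // eqxx.
split=> [|A' k [A'_adm A'_opt]].
  exists A => k; split=> // A' m1 m2 A'_adm [b [e [ph tr]]] f2.
  have [b' [e' [ph' tr']]] := A_forces k.
  have [eb ee] := is_phase_uniq ph ph'; rewrite -tr eb ee tr'.
  exact: transitions_le f2.
have [b [e [tau [ph _ _]]]] := A'_adm k.
have f : forces s0 A' k (transitions s0 A' b e) by exists b, e.
suff -> : m = transitions s0 A' b e by [].
(* Optimality of [A'] against the competitor [A] gives one inequality, the upper bound the other. *)
by apply/eqP; rewrite eqn_leq (A'_opt _ _ _ A_adm f (A_forces k)) (transitions_le A'_adm f).
Qed.
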